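(* Let $G=(V,E)$ be a simple undirected finite graph with $V=\{v_1,\dots,v_n\}$, and let $(V,w)$ be the energy game on $G$, i.e. $w(S)=\mathcal{E}(I(S))$ for every $S\subset V$. Then the payoff vector $e=(\mathcal{E}_G(v_1),\dots,\mathcal{E}_G(v_n))$ of vertex energies is in the core of the game $(V,w)$.
   Context: For a graph $G$ with vertices $v_1,\dots,v_n$, the adjacency matrix $A(G)$ is the $n\times n$ matrix with $A_{ij}=1$ if $v_i$ and $v_j$ are adjacent and $A_{ij}=0$ otherwise. For a matrix $M$, $|M|=(MM^* )^{1/2}$. The energy of $G$ is $\mathcal{E}(G)=\operatorname{Tr}(|A(G)|)$, i.e. the sum of the absolute values of the eigenvalues of $A(G)$ counted with multiplicity (the empty graph has energy $0$). The energy of the vertex $v_i$ in $G$ is $\mathcal{E}_G(v_i)=|A(G)|_{ii}$. For $S\subset V$, $I(S)$ denotes the subgraph of $G$ induced by $S$. The core of a game $(N,w)$ (with $N=\{1,\dots,n\}$, $w:2^N\to\mathbb{R}$, $w(\emptyset)=0$) is the set of vectors $x\in\mathbb{R}^n$ such that $\sum_{i\in S}x_i\geq w(S)$ for each $S\subset N$ and $\sum_{i\in N}x_i=w(N)$. *)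

(* Defs.v *)
From mathcomp Require Import all_boot all_order all_algebra.
From mathcomp Require Import all_classical all_reals.

Set Implicit Arguments.
Unset Strict Implicit.
Unset Printing Implicit Defensive.

Import Order.TTheory GRing.Theory Num.Theory.
Local Open Scope ring_scope.

Definition psdmx (R : realType) (n : nat) (B : 'M[R]_n) : Prop :=
  B \is symmetricmx /\ forall x : 'cV[R]_n, 0 <= (x^T *m B *m x) 0 0.

(* The positive semidefinite square root of M. It exists and is unique when M
   is positive semidefinite; the default value 0 is only used for other M. *)
Definition sqrtmx (R : realType) (n : nat) (M : 'M[R]_n) : 'M[R]_n :=
  xget 0 [set B : 'M[R]_n | psdmx B /\ B *m B = M]%classic.

(* For a real matrix the adjoint M^* is the transpose. *)
Definition absmx (R : realType) (n : nat) (M : 'M[R]_n) : 'M[R]_n :=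
  sqrtmx (M *m M^T).

Record sgraph (V : finType) := SGraph {
  adj :> rel V;
  adj_sym : symmetric adj;
  adj_irr : irreflexive adj }.

(* The vertices are listed as v_i = enum_val i, so v has index enum_rank v. *)
Definition adjmx (R : realType) (V : finType) (G : sgraph V) : 'M[R]_#|V| :=
  \matrix_(i, j) (G (enum_val i) (enum_val j))%:R.

Definition graph_energy (R : realType) (V : finType) (G : sgraph V) : R :=
  \tr (absmx (adjmx R G)).

Definition vertex_energy (R : realType) (V : finType) (G : sgraph V) (v : V) : R :=
  absmx (adjmx R G) (enum_rank v) (enum_rank v).

Section Induced.
Variables (V : finType) (G : sgraph V) (S : {set V}).

Definition induced_adj : rel {v : V | v \in S} := fun x y => G (val x) (val y).

Lemma induced_adj_sym : symmetric induced_adj.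
Proof. by move=> x y; apply: adj_sym. Qed.

Lemma induced_adj_irr : irreflexive induced_adj.
Proof. by move=> x; apply: adj_irr. Qed.

Definition induced : sgraph {v : V | v \in S} :=
  SGraph induced_adj_sym induced_adj_irr.

End Induced.

Record game (R : realType) (N : finType) := Game {
  worth :> {set N} -> R;
  worth0 : worth finset.set0 = 0 }.

Definition core (R : realType) (N : finType) (w : game R N) :
    set {ffun N -> R} :=
  [set x : {ffun N -> R} | (forall S : {set N}, w S <= \sum_(i in S) x i)
     /\ \sum_(i : N) x i = w finset.setT]%classic.

Lemma induced_energy0 (R : realType) (V : finType) (G : sgraph V) :
  graph_energy R (induced G finset.set0) = 0.
Proof.
rewrite /graph_energy /mxtrace big1 // => i _.
by case: (enum_val i) => v; rewrite finset.in_set0.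
Qed.

Definition energy_game (R : realType) (V : finType) (G : sgraph V) : game R V :=
  @Game R V (fun S : {set V} => graph_energy R (induced G S))
    (induced_energy0 R G).

(* Main.v *)
(* Write |A| for the absolute value of the adjacency matrix. Diagonalizing A in
   an orthonormal basis gives |x^T A x| <= x^T |A| x for all x, and this passes
   to the principal submatrices B of A and P of |A| indexed by S. If (u_i) is an
   orthonormal eigenbasis of B, then
     Tr |B| = sum_i |u_i^T B u_i| <= sum_i u_i^T P u_i = Tr P,
   which is the core inequality. The spectral theorem over a real closed field
   is obtained from a complex eigenvalue, which is real, and deflation by a
   Householder reflection. *)
Require Import Defs.
From mathcomp Require Import all_boot all_order all_algebra.
From mathcomp Require Import all_classical all_reals.
From mathcomp Require Import complex ring lra.

Set Implicit Arguments.
Unset Strict Implicit.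
Unset Printing Implicit Defensive.

Import Order.TTheory GRing.Theory Num.Theory.
Local Open Scope ring_scope.

(** * Spectral theorem for real symmetric matrices *)

Lemma symmetricmxP (R : realType) n (M : 'M[R]_n) :
  reflect (M^T = M) (M \is symmetricmx).
Proof.
rewrite is_hermitianmxE expr0 scale1r map_mx_id // eq_sym.
exact: eqP.
Qed.

(** The complexification of [B] is Hermitian, hence unitarily diagonalizable with real diagonal. A
    diagonal entry is thus the image of an element of [R], and being an eigenvalue descends along
    the embedding of [R]. *)
Lemma sym_eigenvector (R : rcfType) n (B : 'M[R]_n.+1) :
  B^T = B -> exists a, eigenvalue B a.
Proof.
move=> Bsym; pose C := map_mx (real_complex R) B.
have Cherm : C \is hermsymmx.
  apply: realsym_hermsym.
    by rewrite is_hermitianmxE expr0 scale1r map_mx_id // map_trmx Bsym.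
  by apply/mxOverP => i j; rewrite mxE complex_real.
have /orthomx_spectralP C_eq := hermitian_normalmx Cherm.
have /mxOverP /(_ 0 0) dreal := hermitian_spectral_diag_real Cherm.
exists (complex.Re (spectral_diag C 0 0)).
rewrite -(eigenvalue_map (real_complex R)) /= (RRe_real dreal).
apply/eigenvalueP; exists (row 0 (spectralmx C)); last first.
  apply/negP => /eqP row0.
  have := mulmxV (spectral_unit C) => /(congr1 (row 0)).
  rewrite row_mul row0 mul0mx => /rowP /(_ 0) /eqP.
  by rewrite !mxE eqxx eq_sym oner_eq0.
rewrite -/C -row_mul {2}C_eq !mulmxA mulmxV ?spectral_unit // mul1mx.
by apply/rowP => j; rewrite mul_diag_mx !mxE.
Qed.

Lemma rv_norm_gt0 (R : realDomainType) n (v : 'rV[R]_n) :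
  v != 0 -> 0 < (v *m v^T) 0 0.
Proof.
move=> v0; rewrite mxE lt_neqAle sumr_ge0 => [|i _]; last first.
  by rewrite mxE -expr2 sqr_ge0.
rewrite andbT eq_sym psumr_eq0 => [|i _]; last by rewrite mxE -expr2 sqr_ge0.
apply: contra v0 => /allP v0; apply/eqP/rowP => i.
have := v0 i (mem_index_enum i).
by rewrite !mxE mulf_eq0 orbb => /eqP.
Qed.

(* U is the Householder reflection exchanging v and e_0. *)
Lemma reflection_to_unit (R : realFieldType) n (v : 'rV[R]_n.+1) :
  v *m v^T = 1%:M ->
  exists U : 'M[R]_n.+1,
    [/\ U^T = U, U *m U = 1%:M & delta_mx 0 0 *m U = v].
Proof.
move=> v1; pose e : 'rV[R]_n.+1 := delta_mx 0 0.
have e1 : e *m e^T = 1%:M.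
  by rewrite trmx_delta mul_delta_mx [RHS]mx11_scalar mxE [LHS]mx11_scalar mxE.
have [->|ve] := eqVneq v e; first by exists 1%:M; rewrite trmx1 !mulmx1.
(* The reflection is in the hyperplane orthogonal to [w]. As [v] and [e] are unit vectors, the
   squared norm [c] of [w] is [2 - 2 * t], so that [e] is sent to [e + w = v]. *)
pose w := v - e; pose c := (w *m w^T) 0 0; pose t := (e *m v^T) 0 0.
have c_gt0 : 0 < c by apply: rv_norm_gt0; rewrite subr_eq0.
have ev : e *m v^T = t%:M by rewrite [LHS]mx11_scalar.
have vte : v *m e^T = t%:M by rewrite -[LHS]trmxK trmx_mul trmxK ev tr_scalar_mx.
have cE : c = 2 - 2 * t.
  rewrite /c linearB /= mulmxBl !mulmxBr v1 e1 ev vte.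
  by rewrite !mxE eqxx /= !mulr1n; ring.
have ww : w *m w^T = c%:M by rewrite [LHS]mx11_scalar.
pose X := w^T *m w.
have XX : X *m X = c *: X.
  by rewrite /X mulmxA -(mulmxA w^T) ww mul_mx_scalar -scalemxAl.
exists (1%:M - (2 / c) *: X); split.
- by rewrite linearB linearZ /= trmx1 trmx_mul trmxK.
- rewrite mulmxBl mul1mx [in X in _ - X]mulmxBr mulmx1.
  rewrite -!scalemxAr -!scalemxAl XX !scalerA.
  rewrite (_ : 2 / c * (2 / c) * c = 2 / c + 2 / c) ?scalerDl; last first.
    by field; rewrite gt_eqF.
  by rewrite opprB addrK subrK.
- have ew : e *m w^T = (t - 1)%:M.
    by rewrite linearB /= mulmxBr ev e1 raddfB.
  rewrite mulmxBr mulmx1 -scalemxAr mulmxA ew mul_scalar_mx scalerA.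
  rewrite (_ : 2 / c * (t - 1) = -1); last first.
    rewrite cE; field; move: c_gt0; rewrite cE => ?.
    by apply/eqP; lra.
  by rewrite scaleN1r opprK addrC subrK.
Qed.

(** Induction on the size: conjugating by a reflection that sends [e_0] to a unit eigenvector makes
    the first row a multiple of [e_0]. By symmetry the matrix is then block diagonal, and the
    induction hypothesis diagonalizes the lower block. *)
Theorem sym_spectral (R : rcfType) n (B : 'M[R]_n) : B^T = B ->
  exists (Q : 'M[R]_n) (d : 'rV[R]_n),
    Q *m Q^T = 1%:M /\ B = Q^T *m diag_mx d *m Q.
Proof.
elim: n B => [|n IHn] B Bsym.
  by exists 1%:M, 0; split; apply/matrixP => -[].
have [a /eigenvalueP[u uB u0]] := sym_eigenvector Bsym.
have nu := rv_norm_gt0 u0; pose s := Num.sqrt ((u *m u^T) 0 0).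
have s2 : s * s = (u *m u^T) 0 0 by rewrite -expr2 sqr_sqrtr // ltW.
have s0 : s != 0 by rewrite gt_eqF // sqrtr_gt0.
have [|U [Usym UU eU]] := @reflection_to_unit R n (s^-1 *: u).
  rewrite linearZ /= -scalemxAl -scalemxAr [u *m _]mx11_scalar -s2 scalerA.
  by rewrite scale_scalar_mx; congr _%:M; field.
pose M : 'M_(1 + n) := U *m B *m U.
have Msym : M^T = M by rewrite !trmx_mul Usym Bsym mulmxA.
have Mrow : row 0 M = a *: delta_mx 0 0.
  rewrite rowE !mulmxA eU -scalemxAl uB scalerA mulrC -scalerA -eU.
  by rewrite -scalemxAl -mulmxA UU mulmx1.
have BM : B = U *m M *m U by rewrite /M !mulmxA UU mul1mx -mulmxA UU mulmx1.
clearbody M.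
have Mur : ursubmx M = 0.
  apply/matrixP => i j; move/rowP/(_ (rshift 1 j)): Mrow.
  rewrite !mxE !ord1 /= mulr0 => <-.
  by congr (M _ _); apply: val_inj.
have Mdl : dlsubmx M = 0 by rewrite -[LHS]trmxK trmx_dlsub Msym Mur trmx0.
have [|Q [d [QQ Md]]] := IHn (drsubmx M); first by rewrite trmx_drsub Msym.
pose P : 'M_(1 + n) := block_mx 1%:M 0 0 Q.
have PT : P^T = block_mx 1%:M 0 0 Q^T by rewrite tr_block_mx !trmx0 trmx1.
have PP : P *m P^T = 1%:M.
  rewrite PT mulmx_block QQ !mulmx0 !mul0mx mulmx1 !addr0.
  by rewrite add0r -scalar_mx_block.
have MP : M = P^T *m diag_mx (row_mx (ulsubmx M) d) *m P.
  rewrite -[LHS]submxK Mur Mdl Md diag_mx_row PT !mulmx_block.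
  rewrite !(mulmx0, mul0mx, mulmx1, mul1mx, addr0, add0r).
  congr block_mx; apply/matrixP => i j.
  by rewrite [RHS]mxE !ord1 mulr1n.
exists (P *m U), (row_mx (ulsubmx M) d : 'rV_(1 + n)); split.
  by rewrite trmx_mul Usym mulmxA -(mulmxA P) UU mulmx1.
by rewrite BM [in LHS]MP trmx_mul Usym !mulmxA.
Qed.

(** * Quadratic forms and traces in an orthonormal basis *)

Lemma spectral_form (R : comNzRingType) n (Q : 'M[R]_n) (d : 'rV[R]_n)
    (x : 'cV[R]_n) :
  (x^T *m (Q^T *m diag_mx d *m Q) *m x) 0 0
    = \sum_i d 0 i * (Q *m x) i 0 ^+ 2.
Proof.
rewrite !mulmxA -trmx_mul -mulmxA -mulmxA mul_diag_mx -/(Q *m x) mxE.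
by apply: eq_bigr => i _; rewrite mxE [in RHS]expr2 mulrCA mxE.
Qed.

(** With [orthogonal_trace], this writes a trace as the sum of the values of the quadratic form on
    the orthonormal rows of [Q]. *)
Lemma row_form (R : comNzRingType) n (Q M : 'M[R]_n) i :
  ((row i Q)^T^T *m M *m (row i Q)^T) 0 0 = (Q *m M *m Q^T) i i.
Proof. by rewrite trmxK !mxE; apply: eq_bigr => j _; rewrite -row_mul !mxE. Qed.

Lemma orthogonal_trace (R : comNzRingType) n (Q M : 'M[R]_n) :
  Q *m Q^T = 1%:M -> \tr M = \tr (Q *m M *m Q^T).
Proof. by move=> /mulmx1C QQ; rewrite mxtrace_mulC mulmxA QQ mul1mx. Qed.

Lemma spectral_mulK (R : comNzRingType) n (Q D : 'M[R]_n) :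
  Q *m Q^T = 1%:M -> Q *m (Q^T *m D *m Q) *m Q^T = D.
Proof. by move=> QQ; rewrite !mulmxA QQ mul1mx -mulmxA QQ mulmx1. Qed.

(** * Absolute values of symmetric matrices and their principal submatrices *)

Section AbsoluteValue.
Variable R : realType.

Lemma psdmx_spectral n (Q : 'M[R]_n) (d : 'rV[R]_n) :
  (forall i, 0 <= d 0 i) -> psdmx (Q^T *m diag_mx d *m Q).
Proof.
move=> d_ge0; split.
  by apply/symmetricmxP; rewrite !trmx_mul trmxK tr_diag_mx mulmxA.
by move=> x; rewrite spectral_form sumr_ge0 // => i _; rewrite mulr_ge0 ?sqr_ge0.
Qed.

Lemma psdmx_spectral_ge0 n (Q : 'M[R]_n) (d : 'rV[R]_n) :
  Q *m Q^T = 1%:M -> psdmx (Q^T *m diag_mx d *m Q) -> forall i, 0 <= d 0 i.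
Proof.
move=> QQ [_ psd] i; have := psd (row i Q)^T.
by rewrite row_form spectral_mulK // mxE eqxx.
Qed.

(* For an eigenvector u of P with eigenvalue a, the vector w = u T - a u
   satisfies w T = - a w, so positivity of T forces w = 0. *)
Lemma psdmx_sqrt_unique n (P T : 'M[R]_n) :
  psdmx P -> psdmx T -> P *m P = T *m T -> P = T.
Proof.
move=> psdP [/symmetricmxP Tsym Tpsd] PT.
have [/symmetricmxP Psym _] := psdP.
have [Q [d [QQ Pd]]] := sym_spectral Psym.
have d_ge0 : forall i, 0 <= d 0 i.
  by apply: (@psdmx_spectral_ge0 _ Q) => //; rewrite -Pd.
have QP : Q *m P = diag_mx d *m Q by rewrite Pd !mulmxA QQ mul1mx.
suff QT : Q *m T = diag_mx d *m Q.
  by rewrite -[P]mul1mx -[T]mul1mx -(mulmx1C QQ) -!mulmxA QT QP.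
apply/row_matrixP => i; apply/eqP; rewrite -subr_eq0.
pose u := row i Q; pose a := d 0 i.
have du : row i (diag_mx d *m Q) = a *: u.
  by apply/rowP => j; rewrite mul_diag_mx !mxE.
rewrite row_mul du -/u; pose w := u *m T - a *: u; rewrite -/w.
have uTT : u *m T *m T = a *: (a *: u).
  rewrite -mulmxA -PT mulmxA -row_mul QP du -scalemxAl.
  by rewrite -row_mul QP du.
have wT : w *m T = - (a *: w).
  by rewrite mulmxBl uTT -scalemxAl scalerBr opprB.
apply/negPn/negP => w0; have ww := rv_norm_gt0 w0.
have := Tpsd w^T; rewrite trmxK wT mulNmx -scalemxAl !mxE oppr_ge0.
(* If [a = 0], then [w = u T] and [w T = 0], so [w w^T = w T u^T = 0]. If [a > 0], positivity of [T]
   at [w^T] reads [0 <= - a (w w^T)], which contradicts [ww]. *)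
have := d_ge0 i; rewrite -/a le_eqVlt => /predU1P[a0|a_gt0].
  suff w2 : w *m w^T = 0 by move: ww; rewrite w2 mxE ltxx.
  rewrite {2}/w -a0 scale0r subr0 trmx_mul Tsym mulmxA wT -a0 scale0r oppr0.
  by rewrite mul0mx.
by rewrite pmulr_rle0 // leNgt; move: ww; rewrite mxE => ->.
Qed.

Lemma absmx_spectral n (Q : 'M[R]_n) (d : 'rV[R]_n) : Q *m Q^T = 1%:M ->
  absmx (Q^T *m diag_mx d *m Q)
    = Q^T *m diag_mx (map_mx Num.norm d) *m Q.
Proof.
move=> QQ; set T := RHS.
have psdT : psdmx T by apply: psdmx_spectral => i; rewrite mxE.
have sq (x y : 'rV[R]_n) : (Q^T *m diag_mx x *m Q) *m (Q^T *m diag_mx y *m Q)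
    = Q^T *m (diag_mx x *m diag_mx y) *m Q.
  by rewrite !mulmxA -(mulmxA _ Q) QQ mulmx1 -!mulmxA.
rewrite /absmx /sqrtmx; set S := (S in xget _ S).
(* The explicit root [T] shows that [S] is inhabited, so [xget] returns an element of [S] and not
   its default; uniqueness of the root then identifies it with [T]. *)
have ST : S T.
  split=> //; have -> : (Q^T *m diag_mx d *m Q)^T = Q^T *m diag_mx d *m Q.
    by rewrite !trmx_mul trmxK tr_diag_mx mulmxA.
  rewrite !sq !mulmx_diag.
  congr (_ *m diag_mx _ *m _); apply/rowP => i.
  by rewrite !mxE -normrM ger0_norm // -expr2 sqr_ge0.
have [psdX XX] : S (xget 0 S) by apply: xgetPex; exists T.
apply: psdmx_sqrt_unique => //; rewrite XX.
by case: ST.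
Qed.

(** In the coordinates [y = Q x] this is the triangle inequality for the sum of the [d_i y_i^2]. *)
Lemma absmx_form_ge n (A : 'M[R]_n) (x : 'cV[R]_n) : A^T = A ->
  `|(x^T *m A *m x) 0 0| <= (x^T *m absmx A *m x) 0 0.
Proof.
move=> /sym_spectral[Q [d [QQ ->]]]; rewrite absmx_spectral // !spectral_form.
apply: le_trans (ler_norm_sum _ _ _) _; apply: ler_sum => i _.
by rewrite normrM [`|_ ^+ 2|]ger0_norm ?sqr_ge0 // !mxE.
Qed.

Lemma trace_absmx_le n (B P : 'M[R]_n) : B^T = B ->
  (forall x : 'cV[R]_n, `|(x^T *m B *m x) 0 0| <= (x^T *m P *m x) 0 0) ->
  \tr (absmx B) <= \tr P.
Proof.
move=> /sym_spectral[Q [d [QQ ->]]] BP.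
rewrite absmx_spectral // (orthogonal_trace _ QQ) spectral_mulK //.
rewrite (orthogonal_trace P QQ); apply: ler_sum => i _.
have := BP (row i Q)^T; rewrite !row_form spectral_mulK //.
by rewrite !mxE eqxx.
Qed.

Lemma trace_absmx_mxsub m n (f : 'I_m -> 'I_n) (A : 'M[R]_n) : A^T = A ->
  \tr (absmx (mxsub f f A)) <= \sum_i absmx A (f i) (f i).
Proof.
move=> Asym.
have -> : \sum_i absmx A (f i) (f i) = \tr (mxsub f f (absmx A)).
  by apply: eq_bigr => i _; rewrite mxE.
apply: trace_absmx_le; first by rewrite trmx_mxsub Asym.
(* Row [i] of [J] is the basis vector of index [f i], so the form of a submatrix at [x] is the form
   of the whole matrix at [J^T x]. When [f] is injective, [J^T x] is [x] extended by zero. *)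
move=> x; pose J : 'M[R]_(m, n) := rowsub f 1%:M.
have sub_form M : x^T *m mxsub f f M *m x = (J^T *m x)^T *m M *m (J^T *m x).
  have -> : mxsub f f M = J *m M *m J^T.
    rewrite mxsubcr rowsubE -[colsub f _]trmxK trmx_mxsub rowsubE.
    by rewrite trmx_mul trmxK.
  by rewrite trmx_mul trmxK !mulmxA.
by rewrite !sub_form absmx_form_ge.
Qed.

End AbsoluteValue.

(** * Vertex energies and the core *)

Lemma adjmx_sym (R : realType) (V : finType) (G : sgraph V) :
  (adjmx R G)^T = adjmx R G.
Proof. by apply/matrixP => i j; rewrite !mxE adj_sym. Qed.

(** Stated for a map [h] because it serves twice: for the inclusion of an induced subgraph, and for
    the identification of [G] with the subgraph induced by all vertices. *)
Lemma graph_energy_embedding (R : realType) (V W : finType) (G : sgraph V)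
    (H : sgraph W) (h : W -> V) : (forall x y, H x y = G (h x) (h y)) ->
  graph_energy R H <= \sum_x vertex_energy R G (h x).
Proof.
move=> hadj; pose f (i : 'I_#|W|) := enum_rank (h (enum_val i)).
have -> : graph_energy R H = \tr (absmx (mxsub f f (adjmx R G))).
  congr (\tr (absmx _)); apply/matrixP => i j.
  by rewrite !mxE !enum_rankK hadj.
apply: le_trans (trace_absmx_mxsub f (adjmx_sym R G)) _.
by rewrite [leRHS]big_enum_val.
Qed.

Lemma graph_energyE (R : realType) (V : finType) (G : sgraph V) :
  graph_energy R G = \sum_v vertex_energy R G v.
Proof.
rewrite [RHS]big_enum_val; apply: eq_bigr => i _.
by rewrite /vertex_energy enum_valK.
Qed.

Theorem theorem3p6 (R : realType) (V : finType) (G : sgraph V) :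
  core (energy_game R G) [ffun v : V => vertex_energy R G v].
Proof.
have le_core (S : {set V}) :
    energy_game R G S <= \sum_(v in S) [ffun v : V => vertex_energy R G v] v.
  under eq_bigr do rewrite ffunE.
  by rewrite big_sub; apply: graph_energy_embedding.
split=> //; apply/le_anti/andP; split; last first.
  have := le_core finset.setT.
  by under eq_bigl do rewrite finset.in_setT.
under eq_bigr do rewrite ffunE.
(* The subgraph induced by the full set has a sigma type as its vertex type, so it is only
   isomorphic to [G]. Embedding [G] into it along [h] gives the remaining inequality. *)
pose h (v : V) : {v | v \in finset.setT} := exist _ v (finset.in_setT v).
have h_bij : bijective h by exists val => [v|v] //; apply: val_inj.
rewrite -graph_energyE /= [leRHS]graph_energyE (reindex h) /=; last exact: onW_bij.
exact: graph_energy_embedding.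
Qed.
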